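(* Let $P_5(n)$ be the number of payphone permutations of type (P5) and size $n$. Then $P_5(1) = 1$, $P_5(2) = 2$, $P_5(3) = 4$, and for any integer $n\geq 4$, $$P_5(n) = 2H(S'(n-1)) + H(\{2\}\cup S'(n-2)) + \sum_{i=3}^{n-2} H\big(S'(i-1)\cup S'(n-i)\big),$$ where the function $H$ is defined on the finite multisets $M$ of positive integers by $$H(M) := \bigg(\prod_{k\geq 2} (\#_{2k} M + \#_{2k-1} M)!\bigg) \cdot (\#_2 M)!\cdot (\#_1 M)! \cdot 2^{\sum_{k\geq 1} \#_{2k} M}.$$
   Context: Multisets: $\#_k M$ denotes the multiplicity of $k$ in the multiset $M$, and $\cup$ denotes union of multisets with multiplicities added. For $n\ge 0$, the finite multiset $S(n)$ of positive integers is defined recursively by $S(0)=\emptyset$ and $$S(n)=\{n\}\cup S\left(\left\lfloor\tfrac{n-1}{2}\right\rfloor\right)\cup S\left(\left\lceil\tfrac{n-1}{2}\right\rceil\right)\quad (n\ge 1).$$ Further, $S'(0):=\emptyset$ and $S'(\ell):=S(\ell-1)\cup\{2\ell-1\}$ for $\ell\ge 1$. An empty sum equals $0$. Type (P5) payphone permutations: $n$ payphones, labeled $1,\dots,n$, are arranged in a row; the distance between payphones $i$ and $j$ is $|i-j|$. Persons $1,2,\dots,n$ come one after another and each occupies an available payphone. The first person takes any payphone. Rule (P1) is: a person takes any available payphone such that its closest occupied payphone is as distant as possible. An available payphone is sandwiched if both of its neighbors exist and are occupied. Each person after the first obeys rule (P5): the person follows rule (P1), except that a payphone adjacent to a single occupied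 payphone is preferred to a sandwiched payphone. That is, if some available payphone is at distance at least $2$ from all occupied payphones, the person follows (P1); if every available payphone is adjacent to an occupied one, the person takes any available payphone adjacent to exactly one occupied payphone if there is one (this includes an available end payphone $1$ or $n$ whose only neighbor is occupied), and otherwise takes any (sandwiched) available payphone. The resulting assignment of people to payphones, $(p_1,\dots,p_n)$ with $p_j$ the person occupying payphone $j$, is a payphone permutation of type (P5) and size $n$; $P_5(n)$ counts the distinct permutations of $\{1,\dots,n\}$ that can arise this way. *)

(* Defs.v *)
From mathcomp Require Import all_boot perm ssrint finmap multiset.

Set Implicit Arguments.
Unset Strict Implicit.
Unset Printing Implicit Defensive.

Local Open Scope mset_scope.
Local Open Scope nat_scope.

(* The multiplicity of k in M is [M k]; [`+`] adds multiplicities. *)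

(* [f] bounds the recursion depth; [MS_rec] below is the defining recursion. *)
Fixpoint MS_fuel (f n : nat) : {mset nat} :=
  match f, n with
  | f'.+1, m.+1 => [mset n] `+` MS_fuel f' m./2 `+` MS_fuel f' (uphalf m)
  | _, _ => mset0
  end.

Definition MS (n : nat) : {mset nat} := MS_fuel n n.

Lemma MS_fuelE f n : n <= f -> MS_fuel f n = MS n.
Proof.
suff fuel_eq g : forall a b m, m <= g -> m <= a -> m <= b ->
    MS_fuel a m = MS_fuel b m.
  by move=> le_nf; apply: (fuel_eq n).
elim: g => [|g IHg] [|a] [|b] [|m] //= le_mg le_ma le_mb.
have half_le : m./2 <= m.
  by rewrite leq_half_double -addnn -addnS leq_addr.
have uphalf_le : uphalf m <= m by rewrite leq_uphalf_double -addnn leq_addr.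
by rewrite (IHg a b m./2) ?(IHg a b (uphalf m)) //;
  apply: leq_trans; eassumption.
Qed.

(* For n >= 1, [n.-1./2] and [uphalf n.-1] are the floor and the ceiling of
   (n - 1) / 2. *)
Lemma MS_rec n : 0 < n ->
  MS n = [mset n] `+` MS n.-1./2 `+` MS (uphalf n.-1).
Proof.
case: n => [//|m] _; rewrite {1}/MS /= !MS_fuelE //.
  by rewrite leq_uphalf_double -addnn leq_addr.
by rewrite leq_half_double -addnn -addnS leq_addr.
Qed.

Definition MS' (l : nat) : {mset nat} :=
  if l is l'.+1 then MS l' `+` [mset (2 * l).-1] else mset0.

Definition mset_max (M : {mset nat}) : nat := \max_(x <- enum_mset M) x.

Lemma mset_gt_max (M : {mset nat}) k : mset_max M < k -> M k = 0.
Proof.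
move=> lt_max; apply/eqP; case: eqP => // /eqP Mk_neq0.
have k_in : k \in enum_mset M by rewrite -mset_neq0.
by move: lt_max; rewrite ltnNge (leq_bigmax_seq (F := id) k k_in).
Qed.

(* The product over k >= 2 and the sum over k >= 1 are cut at the largest
   element of M: every later factor is 0! and every later term is 0. *)
Definition H (M : {mset nat}) : nat :=
  (\prod_(2 <= k < (mset_max M).+1) (M (2 * k) + M (2 * k).-1)`!)
  * (M 2)`! * (M 1)`! * 2 ^ (\sum_(1 <= k < (mset_max M).+1) M (2 * k)).

Section Payphones.

(* Payphones and persons 1, ..., n are the elements 0, ..., n - 1 of 'I_n. *)
Variable n : nat.
Implicit Types (A : {set 'I_n}) (i j k : 'I_n) (p : 'S_n).

Definition phone_dist i j : nat := `|Posz i - Posz j|%N.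

(* Distance from j to the closest payphone in A. The default value n exceeds
   every distance, so it only matters when A is empty. *)
Definition closest A j : nat := \big[minn/n]_(i in A) phone_dist i j.

(* In the rules, A is the set of occupied payphones and j is the choice. *)
Definition rule_P1 A j : bool :=
  (j \notin A) && [forall (k | k \notin A), closest A k <= closest A j].

Definition single_adjacent A j : bool :=
  (j \notin A) && (#|[set i in A | phone_dist i j == 1]| == 1).

Definition rule_P5 A j : bool :=
  if [exists (k | k \notin A), 2 <= closest A k] then rule_P1 A j
  else if [exists k, single_adjacent A k] then single_adjacent A j
  else j \notin A.

(* The payphones occupied when person t arrives; p j is the person who ends
   up at payphone j. *)
Definition occupied p (t : nat) : {set 'I_n} := [set i | p i < t].

Definition payphone_perm_P5 p : bool :=
  [forall j, (p j == 0 :> nat) || rule_P5 (occupied p (p j)) j].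

End Payphones.

Definition P5 (n : nat) : nat := #|[set p : 'S_n | payphone_perm_P5 p]|.

(* Main.v *)
(* Give a free payphone priority 1 if it is sandwiched and one more than its
   distance to the closest occupied payphone otherwise; rule (P5) says that a
   payphone of maximal priority is taken. An interior gap of m payphones has
   best priority [level m], attained twice if m is even and once if m is odd,
   and taking a best payphone leaves gaps of sizes floor((m-1)/2) and
   ceil((m-1)/2), both of lower level. A gap of l payphones at an end of the row
   has best priority l + 1, attained only at the end, and then becomes an
   interior gap of size l - 1. So the number of gaps that will ever be filled at
   each level is determined by the current gaps. While q gaps of the top level
   are pending, each of them contributes the fraction 1/q of the completions,
   which yields the factorials, and each even gap contributes a factor 2.
   For l >= 2 an end gap has the same level as an interior gap of size 2l - 1,
   hence S'(l); for l = 1 it has level 2 without the factor 2, which is why the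
   starting positions 2 and n - 1 together contribute a single H-term. *)

Require Import Defs.
From mathcomp Require Import all_boot order perm ssrint finmap multiset zify.

Set Implicit Arguments.
Unset Strict Implicit.
Unset Printing Implicit Defensive.

Local Open Scope mset_scope.
Local Open Scope nat_scope.

(** * From permutations to sequences of choices *)

Section Runs.
Variables (n : nat) (r : {set 'I_n} -> pred 'I_n).

(** The rule sees only the set of occupied payphones, so continuations can be counted without
    recording who stands where. *)
Fixpoint runs (m : nat) (A : {set 'I_n}) : nat :=
  if m is m'.+1 then \sum_(j | r A j) runs m' (j |: A) else 1.

(* The permutations that agree with [s] on the persons before [t] and obey the
   rule from person [t] on. *)
Let extensions (t : nat) (s : 'S_n) : {set 'S_n} :=
  [set p : 'S_n | [forall i, (s i < t) ==> (p i == s i)]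
                  && [forall j, (t <= p j) ==> r (occupied p (p j)) j]].

Lemma occupied_agree (p s : 'S_n) t :
  (forall i, s i < t -> p i = s i) -> occupied p t = occupied s t.
Proof.
move=> agree; apply/setP => i; rewrite !inE; apply/idP/idP => [lt_pi|lt_si].
  (* The payphone that [s] gives to person [p i] gets the same person from [p], so by injectivity it
     is [i]. *)
  have := agree (s^-1%g (p i)); rewrite permKV => /(_ lt_pi) /perm_inj <-.
  by rewrite permKV.
by rewrite agree.
Qed.

Hypothesis r_free : forall A j, r A j -> j \notin A.

(** Extensions are sorted by the payphone [j] of person [t]. Those with a given [j] are the
    extensions, from person [t.+1] on, of a permutation [s'] that agrees with [s] before [t] and
    sends [j] to [t]. *)
Lemma card_extensions m t (s : 'S_n) :
  m + t = n -> #|extensions t s| = runs m (occupied s t).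
Proof.
elim: m t s => [|m IHm] t s /= mtn.
  apply/eqP/cards1P; exists s; apply/setP => p; rewrite !inE.
  apply/andP/eqP => [[/forallP agree _]|->].
    apply/permP => i; apply/eqP; apply: (implyP (agree i)).
    by rewrite -[t]/(0 + t) mtn ltn_ord.
  split; apply/forallP => i; first by rewrite eqxx implybT.
  by rewrite leqNgt; rewrite -[t]/(0 + t) mtn ltn_ord.
have tn : t < n by lia.
pose u := Ordinal tn.
have agreeP p : p \in extensions t s -> forall i, s i < t -> p i = s i.
  rewrite inE => /andP[/forallP agree _] i lt_si; apply/eqP.
  exact: (implyP (agree i)).
rewrite -sum1_card.
rewrite (partition_big (fun p : 'S_n => p^-1%g u) (r (occupied s t))) /=; last first.
  move=> p ext_p; rewrite -(occupied_agree (agreeP p ext_p)).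
  move: ext_p; rewrite inE => /andP[_ /forallP /(_ (p^-1%g u))].
  by rewrite permKV leqnn.
apply: eq_bigr => j rj.
have le_tsj : t <= s j by move: (r_free rj); rewrite inE -leqNgt.
(* Persons [s j] and [t] trade places; as [t <= s j], nobody before [t] moves. *)
pose s' := (s * tperm (s j) u)%g.
have s'j : s' j = u by rewrite permM tpermL.
have s'E i : s i < t -> s' i = s i.
  move=> lt_si; rewrite permM tpermD //; apply/eqP => e; move: lt_si;
    rewrite -e ?ltnn //.
  by rewrite ltnNge le_tsj.
have s'_lt i : s' i < t.+1 -> i != j -> s i < t.
  move=> lt_s'i nij; move: lt_s'i; rewrite permM.
  have nsij : s j != s i by rewrite (inj_eq perm_inj) eq_sym.
  case: tpermP => [e|e|_ /eqP nsu].
  - by rewrite e eqxx in nsij.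
  - rewrite ltnS => le_sjt; have sju : s j = u by apply: val_inj => /=; lia.
    by rewrite sju e eqxx in nsij.
  - by rewrite ltnS leq_eqVlt => /orP[/eqP e|//]; case/eqP: nsu; apply: val_inj.
have -> : j |: occupied s t = occupied s' t.+1.
  apply/setP => i; rewrite !inE; have [->|nij] /= := eqVneq i j.
    by rewrite s'j /= ltnSn.
  apply/idP/idP => [lt_si|/s'_lt->//]; by rewrite s'E // ltnW.
rewrite -(IHm t.+1 s') ?addnS // -sum1_card; apply: eq_bigl => p.
apply/andP/idP => [[ext_p /eqP pj]|].
  have {}pj : p j = u by rewrite -pj permKV.
  have agree := agreeP _ ext_p.
  move: ext_p; rewrite !inE => /andP[_ /forallP rp].
  apply/andP; split; apply/forallP => i.
    apply/implyP => lt_s'i; have [->|nij] := eqVneq i j; first by rewrite pj s'j.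
    by have lt_si := s'_lt i lt_s'i nij; rewrite agree // s'E.
  by apply/implyP => /ltnW; apply/implyP.
rewrite inE => /andP[/forallP agree /forallP rp].
have {}agree i : s' i < t.+1 -> p i = s' i.
  by move=> ?; apply/eqP; exact: (implyP (agree i)).
have agree_s i : s i < t -> p i = s i.
  by move=> lt_si; rewrite agree s'E // ltnW.
have pj : p j = u by rewrite agree s'j /= ?ltnSn.
split; last by rewrite -pj permK.
rewrite inE; apply/andP; split; apply/forallP => i.
  by apply/implyP => /agree_s->.
apply/implyP; rewrite leq_eqVlt => /orP[/eqP e|lt]; last exact: (implyP (rp i)).
have ij : i = j by apply: (@perm_inj _ p); rewrite pj; apply: val_inj; rewrite /= -e.
by rewrite ij pj (occupied_agree agree_s).
Qed.

Lemma card_perm_runs :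
  #|[set p : 'S_n | [forall j, r (occupied p (p j)) j]]| = runs n set0.
Proof.
have -> : set0 = occupied (1%g : 'S_n) 0 by apply/setP => i; rewrite !inE.
rewrite -card_extensions ?addn0 //; apply: eq_card => p; rewrite !inE /=.
have -> // : [forall i, ((1%g : 'S_n) i < 0) ==> (p i == (1%g : 'S_n) i)].
exact/forallP.
Qed.

End Runs.

(** * Levels of gap sizes and their multiplicities in S(m) *)

(** For [m >= 2] this is one more than the best distance; a gap of size 1 is sandwiched and has
    priority 1. *)
Definition level (m : nat) : nat := if m <= 1 then m else m.+1./2.+1.

(** For [k >= 3] the sizes of level [k] are 2k - 3 and 2k - 2, while sizes 1 and 2 are each alone in
    their level. Hence the separate factorials in [H]. *)
Definition level_mult (M : {mset nat}) (k : nat) : nat :=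
  if k < 3 then M k else M (2 * k - 2) + M (2 * k - 3).

(** The exponent of 2 in [H], with a cut independent of [M] so that it is additive in [M]. *)
Definition even_mult (n : nat) (M : {mset nat}) : nat :=
  \sum_(1 <= k < n) M (2 * k).

Lemma level_mult0 k : level_mult mset0 k = 0.
Proof. by rewrite /level_mult !mset0E; case: ifP. Qed.

Lemma even_mult0 n : even_mult n mset0 = 0.
Proof. by rewrite /even_mult big1 // => k _; rewrite mset0E. Qed.

Lemma level_multD M N k :
  level_mult (M `+` N) k = level_mult M k + level_mult N k.
Proof. by rewrite /level_mult !msetE2; case: ifP => // _; rewrite addnACA. Qed.

Lemma level_mult1 m k : 0 < m -> level_mult [mset m] k = (k == level m).
Proof.
by rewrite /level_mult /level !msetnE => ?; do ![case: ifP => ?]; lia.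
Qed.

Lemma even_multD n M N : even_mult n (M `+` N) = even_mult n M + even_mult n N.
Proof. by rewrite /even_mult -big_split; apply: eq_bigr => k _; rewrite msetE2. Qed.

Lemma even_mult1 n m : 0 < m <= n -> even_mult n [mset m] = ~~ odd m.
Proof.
move=> m_bnd; rewrite /even_mult; have [odd_m|even_m] := boolP (odd m).
  by rewrite big1 // => k _; rewrite msetnE; case: eqP => //; lia.
rewrite (bigD1_seq m./2) ?mem_index_iota ?iota_uniq //=; last by lia.
rewrite msetnE big1 => [|k nk]; last by rewrite msetnE; case: ifP; lia.
by case: ifP; lia.
Qed.

Lemma MS_gt m k : m < k -> MS m k = 0.
Proof.
have [b le_mb] := ubnP m; elim: b m k le_mb => // b IHb [|m] k le_mb lt_mk.
  by rewrite mset0E.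
rewrite MS_rec // !msetE2 msetnE !IHb /=; try lia; by case: ifP; lia.
Qed.

Lemma level_mult_MS m k : 0 < m ->
  level_mult (MS m) k =
  (k == level m) + level_mult (MS m.-1./2) k + level_mult (MS (uphalf m.-1)) k.
Proof. by move=> m_gt0; rewrite MS_rec // !level_multD level_mult1. Qed.

Lemma even_mult_MS n m : 0 < m <= n ->
  even_mult n (MS m) =
  ~~ odd m + even_mult n (MS m.-1./2) + even_mult n (MS (uphalf m.-1)).
Proof. by move=> m_bnd; rewrite MS_rec ?even_multD ?even_mult1 //; lia. Qed.

Lemma level_mult_MS_gt m k : level m < k -> level_mult (MS m) k = 0.
Proof.
rewrite /level /level_mult => lt_k; case: ifP => k3; rewrite !MS_gt //;
  by move: lt_k; case: ifP; lia.
Qed.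

Lemma level_mult_MS_level m : 0 < m -> level_mult (MS m) (level m) = 1.
Proof.
by move=> m_gt0; rewrite level_mult_MS // eqxx !level_mult_MS_gt //;
  rewrite /level; do ![case: ifP => ? //=]; lia.
Qed.

(* A gap (x, y) consists of the payphones strictly between the walls x and y,
   where payphones are numbered from 1 and 0 and n.+1 are the ends of the row. *)
Section Gaps.
Variable n : nat.
Implicit Types x y z k : nat.

Let end_gap x y := (x == 0) || (y == n.+1).

(** The first case is the sandwiched payphone. An end of the row is not an occupied payphone, so
    next to it only the other wall determines the distance. *)
Definition gap_prio x y z : nat :=
  if [&& x != 0, y != n.+1, z == x.+1 & y == z.+1] then 1 else
  (if x == 0 then y - z else if y == n.+1 then z - x else minn (z - x) (y - z)).+1.

Definition gap_level x y : nat :=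
  if end_gap x y then y - x else level (y - x).-1.

(** Counts the gap and all gaps that will arise inside it. Empty gaps are treated first, since an
    empty end gap would otherwise count at level 1. *)
Definition gap_mult k x y : nat :=
  if y - x <= 1 then 0
  else if end_gap x y then (k == y - x) + level_mult (MS (y - x - 2)) k
  else level_mult (MS (y - x).-1) k.

Definition gap_even x y : nat :=
  even_mult n (MS (if end_gap x y then y - x - 2 else (y - x).-1)).

(* Whether two payphones of the gap, rather than one, have maximal priority. *)
Definition gap_tie x y : bool := ~~ end_gap x y && odd (y - x).

Lemma gap_prio_le x y z : x < z < y -> y <= n.+1 -> (x != 0) || (y != n.+1) ->
  gap_prio x y z <= gap_level x y.
by rewrite /gap_prio /gap_level /end_gap /level; do ![case: ifP => ? //=]; lia. Qed.

Lemma gap_prio_leq_n x y z : x < z < y -> y <= n.+1 -> (x != 0) || (y != n.+1) ->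
  gap_prio x y z <= n.
Proof. by rewrite /gap_prio; do ![case: ifP => ? //=]; lia. Qed.

(** Levels drop strictly when a gap is split, so from its own level upwards only the gap itself is
    counted. *)
Lemma gap_mult_level x y k : x.+1 < y ->
  gap_level x y <= k -> gap_mult k x y = (k == gap_level x y).
Proof.
rewrite /gap_mult /gap_level => lt_xy; have /negbTE-> : ~~ (y - x <= 1) by lia.
case: ifP => _ /=; rewrite leq_eqVlt.
  move=> le_k; rewrite level_mult_MS_gt ?addn0 //.
  by rewrite /level; case: ifP; lia.
case/orP => [/eqP <-|lt_k]; first by rewrite level_mult_MS_level ?eqxx //; lia.
by rewrite level_mult_MS_gt //; lia.
Qed.

Lemma gap_prio_eq x y z : x < z < y -> y <= n.+1 -> (x != 0) || (y != n.+1) ->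
  (gap_prio x y z == gap_level x y) =
  (z == if x == 0 then 1 else if y == n.+1 then n else (x + y)./2)
  || gap_tie x y && (z == (x + y)./2.+1).
Proof.
by rewrite /gap_prio /gap_level /gap_tie /end_gap /level; do ![case: ifP => ? //=]; lia.
Qed.


Lemma gap_mult_end k x y : end_gap x y -> x.+1 < y ->
  gap_mult k x y = (k == y - x) + level_mult (MS (y - x - 2)) k.
Proof. by move=> exy lt_xy; rewrite /gap_mult exy; case: ifP => //; lia. Qed.

Lemma gap_mult_interior k x y : x != 0 -> y != n.+1 ->
  gap_mult k x y = level_mult (MS (y - x).-1) k.
Proof.
move=> /negbTE x0 /negbTE yn; rewrite /gap_mult /end_gap x0 yn /=; case: ifP => // le1.
by have -> : (y - x).-1 = 0 by [lia]; rewrite level_mult0.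
Qed.

Lemma gap_mult_empty k x y : y - x <= 1 -> gap_mult k x y = 0.
Proof. by rewrite /gap_mult => ->. Qed.

Lemma gap_even_empty x y : y - x <= 1 -> gap_even x y = 0.
Proof.
move=> le1; rewrite /gap_even; have -> : y - x - 2 = 0 by lia.
by have -> : (y - x).-1 = 0 by [lia]; rewrite if_same even_mult0.
Qed.

Lemma gap_even_end x y : end_gap x y ->
  gap_even x y = even_mult n (MS (y - x - 2)).
Proof. by rewrite /gap_even => ->. Qed.

Lemma gap_even_interior x y : x != 0 -> y != n.+1 ->
  gap_even x y = even_mult n (MS (y - x).-1).
Proof. by rewrite /gap_even /end_gap => /negbTE-> /negbTE->. Qed.

(** This is the recursion of S(m) read on gaps. In an end gap the best payphone is at the end of the
    row, so one part is empty and the other is interior. *)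
Lemma gap_split x y z : x < z < y -> y <= n.+1 -> (x != 0) || (y != n.+1) ->
  gap_prio x y z = gap_level x y ->
  (forall k, gap_mult k x y = (k == gap_level x y) + (gap_mult k x z + gap_mult k z y))
  /\ gap_even x y = gap_tie x y + (gap_even x z + gap_even z y).
Proof.
move=> lt_xzy le_yn not_both /eqP; rewrite gap_prio_eq //.
rewrite /gap_tie /gap_level; have [exy|nexy] /= := boolP (end_gap x y).
  have [x0|x0] := eqVneq x 0; rewrite orbF => /eqP z_eq; last first.
    have /eqP yn : y == n.+1 by move: exy; rewrite /end_gap (negbTE x0).
    rewrite yn eqxx in z_eq; split=> [k|].
      rewrite [gap_mult k z y]gap_mult_empty
        ?[gap_mult k x y]gap_mult_end ?gap_mult_interior ?addn0 //; try lia.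
      by congr (_ + level_mult (MS _) _); lia.
    rewrite [gap_even z y]gap_even_empty
        ?[gap_even x y]gap_even_end ?gap_even_interior ?addn0 //; try lia.
    by congr (even_mult n (MS _)); lia.
  subst x; split=> [k|].
    rewrite [gap_mult k 0 z]gap_mult_empty
        ?[gap_mult k 0 y]gap_mult_end ?gap_mult_interior //; try lia.
    by congr (_ + level_mult (MS _) _); lia.
  rewrite [gap_even 0 z]gap_even_empty
        ?[gap_even 0 y]gap_even_end ?gap_even_interior //; try lia.
  by congr (even_mult n (MS _)); lia.
move: nexy; rewrite /end_gap negb_or => /andP[x0 yn].
rewrite (negbTE x0) (negbTE yn) => z_eq.
(* Either middle may have been taken, so floor and ceiling can occur on either side. *)
have halves : (z - x).-1 = (y - x).-1.-1./2 /\ (y - z).-1 = uphalf (y - x).-1.-1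
   \/ (y - z).-1 = (y - x).-1.-1./2 /\ (z - x).-1 = uphalf (y - x).-1.-1.
  by case/orP: z_eq => [/eqP z_eq|/andP[? /eqP z_eq]]; lia.
split=> [k|].
  rewrite !gap_mult_interior //; try lia.
  rewrite level_mult_MS; last by lia.
  by case: halves => -[-> ->]; rewrite -addnA // [level_mult (MS _./2) _ + _]addnC.
rewrite !gap_even_interior //; try lia.
rewrite even_mult_MS; last by lia.
have -> : ~~ odd (y - x).-1 = odd (y - x) by lia.
by case: halves => -[-> ->]; rewrite -addnA // [even_mult _ (MS _./2) + _]addnC.
Qed.

End Gaps.

(** * Cutting the row at the occupied payphones *)

Lemma eq_pairmap (F G : nat -> nat -> nat) x s :
  (forall s1 y s2, s = s1 ++ y :: s2 -> F (last x s1) y = G (last x s1) y) ->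
  pairmap F x s = pairmap G x s.
Proof.
elim: s x => [|y s IHs] x eqFG //=; congr (_ :: _).
  exact: (eqFG [::] y s).
by apply: IHs => s1 z s2 es; apply: (eqFG (y :: s1) z s2); rewrite es.
Qed.

Lemma path_ltn_split x s z : path ltn x s -> x < z <= last x s -> z \notin s ->
  exists s1 y s2, s = s1 ++ y :: s2 /\ last x s1 < z < y.
Proof.
elim: s x => [|y s IHs] x /=; first by lia.
move=> /andP[lt_xy y_s] z_bnd; rewrite inE negb_or => /andP[nzy z_s].
have [lt_zy|le_yz] := ltnP z y; first last.
  have [|s1 [w [s2 [-> s1_w]]]] := IHs y y_s _ z_s; first by lia.
  by exists (y :: s1), w, s2.
by exists [::], y, s; rewrite /= lt_zy; case/andP: z_bnd => ->.
Qed.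

Lemma sum_between n (P : pred 'I_n) (F : 'I_n -> nat) x s : path ltn x s ->
  \sum_(j : 'I_n | [&& x < j.+1 <= last x s, j.+1 \notin s & P j]) F j =
  sumn (pairmap (fun a b => \sum_(j : 'I_n | (a < j.+1 < b) && P j) F j) x s).
Proof.
elim: s x => [|y s IHs] x /=; first by move=> _; rewrite big_pred0 // => j; lia.
move=> /andP[lt_xy y_s]; rewrite -IHs // (bigID (fun j : 'I_n => j.+1 < y)) /=.
have last_y : y <= last y s.
  have := path_sorted y_s; have := mem_last y s; rewrite inE => /orP[/eqP->//|in_s] _.
  by have /(order_path_min ltn_trans)/allP/(_ _ in_s) := y_s; apply: ltnW.
(* The later walls exceed [y], so they exclude no index up to [y]. *)
have s_gt j : j <= y -> j \notin s.
  move=> le_jy; apply/negP => j_s.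
  by have /(order_path_min ltn_trans)/allP/(_ _ j_s) := y_s => /=; lia.
congr (_ + _); apply: eq_bigl => j; rewrite inE negb_or.
  have [lt_jy|] := boolP (j.+1 < y); last by rewrite !andbF.
  by rewrite (s_gt _ (ltnW lt_jy)); case: (P j) => /=; lia.
have [e|ne] := eqVneq j.+1 y; first by rewrite e ltnn /= !andbF.
by case: (_ \notin s); case: (P j) => /=; lia.
Qed.

Section Walls.
Variable n : nat.
Implicit Types (A : {set 'I_n}) (i j : 'I_n).

(* Payphones are shifted by one, so that the row is bounded by 0 and n.+1;
   the wall at 0 is left implicit. *)
Definition walls A : seq nat :=
  rcons (sort leq [seq j.+1 | j : 'I_n <- enum A]) n.+1.

Lemma mem_walls A z :
  (z \in walls A) = (z == n.+1) || [exists j in A, z == j.+1].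
Proof.
rewrite mem_rcons inE mem_sort; congr (_ || _).
apply/mapP/exists_inP => -[j jA zj]; exists j => //; last exact/eqP.
  by rewrite mem_enum in jA.
  by rewrite zj.
  by rewrite mem_enum.
Qed.

Lemma ord_mem_walls A j : (j.+1 \in walls A) = (j \in A).
Proof.
rewrite mem_walls; have -> : (j.+1 == n.+1) = false by have := ltn_ord j; lia.
by apply/exists_inP/idP => [[i iA /eqP[/val_inj->]]|jA] //; exists j.
Qed.

Lemma walls_path A : path ltn 0 (walls A).
Proof.
rewrite rcons_path; set s := sort _ _.
have s_bnd z : z \in s -> 0 < z <= n.
  by rewrite mem_sort => /mapP[j _ ->]; rewrite ltnS /=; exact: ltn_ord.
apply/andP; split; last first.
  by have := mem_last 0 s; rewrite inE => /orP[/eqP->|/s_bnd] //=; lia.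
rewrite (path_sortedE ltn_trans); apply/andP; split.
  by apply/allP => z /s_bnd/andP[].
rewrite ltn_sorted_uniq_leq sort_uniq sort_sorted ?andbT; last exact: leq_total.
by rewrite map_inj_uniq ?enum_uniq // => i j [/val_inj].
Qed.

Lemma last_walls A : last 0 (walls A) = n.+1.
Proof. by rewrite last_rcons. Qed.

(** For empty [s1], [last 0 s1] is the implicit wall 0. *)
Definition is_gap A x y : Prop :=
  exists s1 s2, walls A = s1 ++ y :: s2 /\ x = last 0 s1.

Definition gap_sum (F : nat -> nat -> nat) A : nat :=
  sumn (pairmap F 0 (walls A)).

Lemma eq_gap_sum F G A : (forall x y, is_gap A x y -> F x y = G x y) ->
  gap_sum F A = gap_sum G A.
Proof.
move=> eqFG; congr sumn; apply: eq_pairmap => s1 y s2 wA.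
by apply: eqFG; exists s1, s2.
Qed.

Lemma gap_ltn A x y : is_gap A x y -> x < y <= n.+1.
Proof.
move=> [s1 [s2 [wA ->]]]; have := walls_path A.
rewrite wA cat_path /= => /and3P[_ -> _] /=.
have : y \in walls A by rewrite wA mem_cat inE eqxx orbT.
by rewrite mem_walls => /orP[/eqP->|/exists_inP[j _ /eqP->]] //; rewrite ltnS ltnW.
Qed.

Lemma gap_outside A x y i : is_gap A x y -> i \in A -> (i.+1 <= x) || (y <= i.+1).
Proof.
move=> [s1 [s2 [wA ->]]]; rewrite -ord_mem_walls wA mem_cat inE.
have := walls_path A; rewrite wA cat_path /= => /and3P[s1_path _ s2_path].
case/or3P => [i_s1|/eqP->|/(allP (order_path_min ltn_trans s2_path))/ltnW->];
  rewrite ?leqnn ?orbT //.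
case/splitPr: i_s1 s1_path => s3 s4.
rewrite cat_path last_cat /= => /and3P[_ _ s4_path].
have := mem_last i.+1 s4; rewrite inE => /orP[/eqP->|]; first by rewrite leqnn.
by move/(allP (order_path_min ltn_trans s4_path))/ltnW->.
Qed.

Lemma gap_notin A x y j : is_gap A x y -> x < j.+1 < y -> j \notin A.
Proof. by move=> gap_xy lt_j; apply/negP => /(gap_outside gap_xy); lia. Qed.

Lemma gap_left A x y : is_gap A x y -> x != 0 -> exists2 i, i \in A & i.+1 = x.
Proof.
move=> gap_xy x0; have := gap_ltn gap_xy; case: gap_xy => s1 [s2 [wA xE]] xy.
have : x \in walls A.
  have := mem_last 0 s1; rewrite -xE inE (negbTE x0) /= => x_s1.
  by rewrite wA mem_cat x_s1.
by rewrite mem_walls => /orP[|/exists_inP[i iA /eqP->]]; [lia|exists i].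
Qed.

Lemma gap_right A x y : is_gap A x y -> y != n.+1 -> exists2 i, i \in A & i.+1 = y.
Proof.
move=> [s1 [s2 [wA _]]] yn; have : y \in walls A by rewrite wA mem_cat inE eqxx orbT.
by rewrite mem_walls (negbTE yn) => /exists_inP[i iA /eqP->]; exists i.
Qed.

Lemma gap_not_both A x y : A != set0 -> is_gap A x y -> (x != 0) || (y != n.+1).
Proof.
case/set0Pn => i iA gap_xy; have := gap_outside gap_xy iA; have := ltn_ord i.
by have := gap_ltn gap_xy; lia.
Qed.

Lemma ex_gap A j : j \notin A -> exists x y, is_gap A x y /\ x < j.+1 < y.
Proof.
rewrite -ord_mem_walls => /(path_ltn_split (walls_path A)) [].
  by have := ltn_ord j; rewrite last_walls; lia.
by move=> s1 [y [s2 [wA lt_j]]]; exists (last 0 s1), y; split=> //; exists s1, s2.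
Qed.

(** The new wall [j.+1] falls between [x] and [y] and affects no other summand. Adding [F x y] on
    the left avoids truncated subtraction. *)
Lemma gap_sumU1 F A x y j : is_gap A x y -> x < j.+1 < y ->
  gap_sum F (j |: A) + F x y = gap_sum F A + (F x j.+1 + F j.+1 y).
Proof.
move=> [s1 [s2 [wA ->]]] /andP[lt_xj lt_jy].
have -> : gap_sum F (j |: A) = sumn (pairmap F 0 (s1 ++ j.+1 :: y :: s2)).
  (* Two strictly increasing lists with the same elements are equal. *)
  congr (sumn (pairmap _ _ _)); apply: (irr_sorted_eq ltn_trans ltnn).
  - exact: path_sorted (walls_path _).
  - apply: (@path_sorted _ _ 0); have := walls_path A; rewrite wA !cat_path /=.
    by rewrite lt_xj lt_jy => /and3P[-> _ ->].
  move=> z; have -> : (z \in s1 ++ j.+1 :: y :: s2) = (z == j.+1) || (z \in walls A).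
    by rewrite wA !mem_cat !inE orbCA.
  rewrite !mem_walls orbCA; congr (_ || _).
  apply/exists_inP/orP => [[i]|].
    by rewrite !inE => /orP[/eqP->|iA zi]; [left|right; apply/exists_inP; exists i].
  case=> [zj|/exists_inP[i iA zi]]; first by exists j; rewrite ?setU11.
  by exists i; rewrite ?setU1r.
rewrite /gap_sum wA !pairmap_cat !sumn_cat /=; lia.
Qed.

Lemma sum_free A (P : pred 'I_n) (F : 'I_n -> nat) :
  \sum_(j | (j \notin A) && P j) F j =
  gap_sum (fun x y => \sum_(j : 'I_n | (x < j.+1 < y) && P j) F j) A.
Proof.
rewrite /gap_sum -sum_between ?walls_path //; apply: eq_bigl => j.
by rewrite ord_mem_walls last_walls ltn0Sn ltnS (ltnW (ltn_ord j)).
Qed.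
End Walls.

(** * Rule (P5) as maximality of a priority *)

Section Priority.
Variable n : nat.
Implicit Types (A : {set 'I_n}) (i j k : 'I_n).

Lemma phone_distE i j : phone_dist i j = (i - j) + (j - i).
Proof. rewrite /phone_dist; lia. Qed.

Lemma closest_le A i j : i \in A -> closest A j <= phone_dist i j.
Proof.
by move=> iA; rewrite /closest -minEnat -leEnat Order.TotalTheory.bigmin_le_cond.
Qed.

Lemma closest_ge A j m : m <= n -> (forall i, i \in A -> m <= phone_dist i j) ->
  m <= closest A j.
Proof.
move=> le_mn le_m; rewrite /closest; elim/big_ind: _ => // a b le_ma le_mb.
by rewrite leq_min le_ma.
Qed.

Lemma closest_gt0 A j : j \notin A -> 0 < closest A j.
Proof.
move=> jA; apply: closest_ge => [|i iA]; first by have := ltn_ord j; lia.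
rewrite phone_distE; have : i <> j :> nat by move/val_inj=> ij; rewrite -ij iA in jA.
lia.
Qed.

Definition adjacent A j : {set 'I_n} := [set i in A | phone_dist i j == 1].

Lemma closest_adjacent A j : A != set0 -> j \notin A ->
  (closest A j <= 1) = (0 < #|adjacent A j|).
Proof.
move=> A0 jA; apply/idP/card_gt0P => [|[i]]; last first.
  by rewrite inE => /andP[iA /eqP dij]; rewrite -dij closest_le.
move=> le1; case: (pickP (mem (adjacent A j))) => [i adj_i|none]; first by exists i.
have neq i : i \in A -> i <> j :> nat by move=> iA /val_inj ij; rewrite -ij iA in jA.
have : 2 <= closest A j; last by lia.
apply: closest_ge => [|i iA].
  (* [A] has an element other than [j], so [n] is at least 2. *)
  case/set0Pn: A0 => i iA; have := neq i iA; have := ltn_ord i; have := ltn_ord j; lia.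
have := none i; rewrite /= inE iA /=; have := neq i iA; rewrite phone_distE; lia.
Qed.

(** A payphone has at most two neighbors, so the test says that [j] is sandwiched. *)
Definition prio A j : nat := if 1 < #|adjacent A j| then 1 else (closest A j).+1.

(** A payphone at distance at least 2 has priority at least 3, and those adjacent to occupied ones
    have at most 2, so the best priority means the largest distance. If no payphone is that far,
    priority 2 marks the single-adjacent ones and 1 the sandwiched ones. *)
Lemma rule_P5_prio A j : A != set0 ->
  rule_P5 A j = (j \notin A) && [forall (k | k \notin A), prio A k <= prio A j].
Proof.
move=> A0; rewrite /rule_P5 /rule_P1 /single_adjacent /prio.
case: (boolP (j \in A)) => /= jA; first by rewrite if_same if_same.
have gt0 k : k \notin A -> 0 < closest A k by exact: closest_gt0.
have adj k : k \notin A -> (closest A k <= 1) = (0 < #|adjacent A k|).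
  by move=> kA; apply: closest_adjacent.
case: ifP => [/exists_inP[k0 k0A far]|near].
  have far_prio k : k \notin A -> 1 < closest A k -> (1 < #|adjacent A k|) = false.
    by move=> kA; rewrite ltnNge adj //; case: #|_|.
  apply/forall_inP/forall_inP => le_j k kA.
    have farj := leq_trans far (le_j k0 k0A); rewrite (far_prio j) //.
    by have := le_j k kA; case: ifP.
  have := le_j k0 k0A; rewrite (far_prio k0) //.
  case: ifP => [_|_]; first by lia.
  rewrite ltnS => le_k0j; have := le_j k kA.
  have [le1 _|farK] := leqP (closest A k) 1; first by lia.
  rewrite (far_prio k) // (far_prio j) //; lia.
have near1 k : k \notin A -> closest A k = 1.
  move=> kA; apply/eqP; rewrite eqn_leq gt0 // andbT leqNgt.
  by apply/negP => far; case/negbT/exists_inP: near; exists k.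
have adj1 k : k \notin A -> 0 < #|adjacent A k| by move=> kA; rewrite -adj // near1.
have adj1j := adj1 _ jA; rewrite near1 //; case: ifP => [/existsP[k /andP[kA k1]]|none].
  apply/idP/forall_inP => [j1 i iA|le_j].
    by rewrite near1 //; have := adj1 i iA; rewrite /adjacent (eqP j1) /=; case: ifP.
  have := le_j k kA; rewrite near1 // /adjacent (eqP k1) /=.
  move: adj1j; rewrite /adjacent.
  by case: #|_| => [|[|m]].
symmetry; apply/forall_inP => k kA; rewrite near1 //.
have -> : 1 < #|adjacent A k|; last by case: ifP.
have := adj1 k kA; have : ~~ (#|adjacent A k| == 1); last by case: #|_| => [|[|m]].
by apply/negP => k1; case/negbT/existsP: none; exists k; rewrite kA.
Qed.

Lemma adjacent_gap A x y j : is_gap A x y -> x < j.+1 < y ->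
  (1 < #|adjacent A j|) = [&& x != 0, y != n.+1, j.+1 == x.+1 & y == j.+2].
Proof.
move=> gap_xy lt_j; apply/card_gt1P/and4P => [[i1 [i2]]|[x0 yn /eqP jx /eqP jy]].
  rewrite !inE !phone_distE => -[/andP[i1A d1] /andP[i2A d2] ni].
  have := gap_outside gap_xy i1A; have := gap_outside gap_xy i2A.
  have := ltn_ord i1; have := ltn_ord i2.
  have : i1 <> i2 :> nat by move/val_inj=> e; rewrite e eqxx in ni.
  by split; lia.
have [i1 i1A i1x] := gap_left gap_xy x0.
have [i2 i2A i2y] := gap_right gap_xy yn.
exists i1, i2; rewrite !inE i1A i2A !phone_distE /=; split; try lia.
by apply/eqP => e; rewrite e in i1x; lia.
Qed.

(** No occupied payphone lies inside the gap, so the closest one is a wall of the gap that is not an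
    end of the row. *)
Lemma prio_gap A x y j : A != set0 -> is_gap A x y -> x < j.+1 < y ->
  prio A j = gap_prio n x y j.+1.
Proof.
move=> A0 gap_xy lt_j; rewrite /prio (adjacent_gap gap_xy) // /gap_prio.
case: ifP => // _; congr _.+1.
have := gap_not_both A0 gap_xy; have := gap_ltn gap_xy => lt_xy not_both.
have le_x : x != 0 -> closest A j <= j.+1 - x.
  move=> /(gap_left gap_xy)[i iA ix]; apply: leq_trans (closest_le j iA) _.
  by rewrite phone_distE; lia.
have le_y : y != n.+1 -> closest A j <= y - j.+1.
  move=> /(gap_right gap_xy)[i iA iy]; apply: leq_trans (closest_le j iA) _.
  by rewrite phone_distE; lia.
apply/eqP; rewrite eqn_leq; apply/andP; split.
  move: not_both le_x le_y; case: ifP => [/eqP-> /= yn _ -> //|x0 _ /= /(_ isT) le_x].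
  by case: ifP => //= _ /(_ isT) le_y; rewrite leq_min le_x.
apply: closest_ge => [|i iA].
  by have := ltn_ord j; do ![case: ifP => //= ?]; lia.
have := gap_outside gap_xy iA; rewrite phone_distE; have := ltn_ord i.
by do ![case: ifP => //= ?]; lia.
Qed.
End Priority.

(** * The product formula for the number of completions *)

Section Count.
Variable n : nat.
Implicit Types (A : {set 'I_n}) (i j : 'I_n).

(** Once a payphone is occupied, priorities are at most [n] by [gap_prio_leq_n], so these levels
    suffice. *)
Definition completion_count A : nat :=
  (\prod_(k < n.+1) (gap_sum (gap_mult n k) A)`!) * 2 ^ gap_sum (gap_even n) A.

(** By [gap_split], taking [j] lowers only the multiplicity at level [prio A j], by one, and a tie
    uses up a factor 2. The right-hand side depends on [j] only through its priority. *)
Lemma completion_countU1 A x y j : A != set0 -> is_gap A x y -> x < j.+1 < y ->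
    prio A j = gap_level n x y ->
  completion_count (j |: A) * 2 ^ gap_tie n x y =
  (\prod_(k < n.+1 | k != prio A j :> nat) (gap_sum (gap_mult n k) A)`!)
  * (gap_sum (gap_mult n (prio A j)) A).-1`! * 2 ^ gap_sum (gap_even n) A.
Proof.
move=> A0 gap_xy lt_j prio_j.
have not_both := gap_not_both A0 gap_xy; have /andP[_ le_yn] := gap_ltn gap_xy.
have prioE := prio_gap A0 gap_xy lt_j; rewrite prioE in prio_j.
have [multE evenE] := gap_split lt_j le_yn not_both prio_j.
have mult_U1 k : gap_sum (gap_mult n k) A =
    (k == prio A j) + gap_sum (gap_mult n k) (j |: A).
  by have := gap_sumU1 (gap_mult n k) gap_xy lt_j; rewrite multE prioE prio_j; lia.
have even_U1 : gap_sum (gap_even n) A = gap_sum (gap_even n) (j |: A) + gap_tie n x y.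
  by have := gap_sumU1 (gap_even n) gap_xy lt_j; rewrite evenE; lia.
have le_prio : prio A j < n.+1 by rewrite ltnS prioE gap_prio_leq_n.
rewrite /completion_count (bigD1 (Ordinal le_prio)) //= -mulnA -expnD -even_U1.
congr (_ * _).
rewrite mulnC mult_U1 eqxx /=; congr (_ * _); apply: eq_big => // k.
by rewrite -val_eqE /= mult_U1 => /negbTE->.
Qed.

Lemma gap_sumMr F A m :
  gap_sum (fun x y => F x y * m) A = gap_sum F A * m.
Proof.
rewrite /gap_sum; elim: (walls A) 0 => //= y s IHs x.
by rewrite IHs mulnDl.
Qed.

Lemma gap_sum_gt0 F A x y : is_gap A x y -> 0 < F x y -> 0 < gap_sum F A.
Proof.
move=> [s1 [s2 [wA ->]]] F_gt0; rewrite /gap_sum wA pairmap_cat sumn_cat /=; lia.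
Qed.

(** If q gaps have the maximal level [K], each of them contributes the same amount [V], obtained
    from [completion_count A] by replacing q! with (q - 1)!; so the sum is q times [V]. *)
Lemma sum_completion_count A : A != set0 -> A != setT ->
  \sum_(j | rule_P5 A j) completion_count (j |: A) = completion_count A.
Proof.
move=> A0 AT.
have [j0 j0A] : exists j, j \notin A.
  by apply/existsP; rewrite -negb_forall; apply: contra AT => /forallP inA;
    apply/eqP/setP => j; rewrite inE inA.
case: (@arg_maxnP _ j0 (fun j => j \notin A) (prio A) j0A) => j1 j1A geq_j1.
set K := prio A j1.
have max_j1 j : j \notin A -> prio A j <= K by exact: geq_j1.
have ruleE j : rule_P5 A j = (j \notin A) && (prio A j == K).
  rewrite rule_P5_prio //; case: (boolP (j \in A)) => //= jA.
  apply/forall_inP/eqP => [le_j|-> k]; last exact: max_j1.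
  by apply/eqP; rewrite eqn_leq max_j1 //= le_j.
set V := (\prod_(k < n.+1 | k != K :> nat) (gap_sum (gap_mult n k) A)`!)
  * (gap_sum (gap_mult n K) A).-1`! * 2 ^ gap_sum (gap_even n) A.
have V_U1 x y j : is_gap A x y -> x < j.+1 < y -> prio A j = K -> gap_level n x y = K ->
    completion_count (j |: A) * 2 ^ gap_tie n x y = V.
  by move=> gap_xy lt_j prio_j level_K; rewrite completion_countU1 ?prio_j.
rewrite (eq_bigl _ _ ruleE) sum_free.
have gap_bounds x y : is_gap A x y -> y <= n.+1 /\ ((x != 0) || (y != n.+1)).
  by move=> gap_xy; have /andP[_ ->] := gap_ltn gap_xy; have := gap_not_both A0 gap_xy.
(* A payphone attaining the level of the gap; it shows that no nonempty gap has level above [K]. *)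
pose mid (x y : nat) := if x == 0 then 1 else if y == n.+1 then n else (x + y)./2.
have mid_bnd x y : is_gap A x y -> x.+1 < y -> x < mid x y < y.
  move=> /gap_bounds[le_yn not_both] wide; rewrite /mid.
  by do ![case: ifP => //= ?]; lia.
have ord_of z : 0 < z < n.+1 -> exists j : 'I_n, z = j.+1.
  by case: z => // z; rewrite /= ltnS => lt_zn; exists (Ordinal lt_zn).
have level_le x y : is_gap A x y -> x.+1 < y -> gap_level n x y <= K.
  move=> gap_xy wide; have lt_mid := mid_bnd x y gap_xy wide.
  have [le_yn not_both] := gap_bounds x y gap_xy.
  have [|j midE] := ord_of (mid x y); first by lia.
  have/eqP <- : gap_prio n x y (mid x y) == gap_level n x y.
    by rewrite gap_prio_eq // eqxx.
  rewrite midE in lt_mid *.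
  by rewrite -(prio_gap A0 gap_xy) // max_j1 // (gap_notin gap_xy).
(* A nonempty gap contributes [V] if its level is [K] and 0 otherwise; as no level exceeds [K],
   [gap_mult n K] is exactly this indicator. *)
rewrite (@eq_gap_sum _ _ (fun x y => gap_mult n K x y * V)) ?gap_sumMr => [|x y gap_xy].
  have [x [y [gap_xy lt_j1]]] := ex_gap j1A.
  have [le_yn not_both] := gap_bounds x y gap_xy.
  have KE : K = gap_prio n x y j1.+1 := prio_gap A0 gap_xy lt_j1.
  have le_K : K < n.+1 by rewrite KE ltnS gap_prio_leq_n.
  have levelE : gap_level n x y = K.
    apply/eqP; rewrite eqn_leq level_le //=; last by lia.
    by rewrite KE gap_prio_le.
  have K_gt0 : 0 < gap_sum (gap_mult n K) A.
    apply: (gap_sum_gt0 gap_xy); rewrite gap_mult_level ?levelE ?eqxx //; lia.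
  rewrite /completion_count (bigD1 (Ordinal le_K)) //= /V !mulnA; congr (_ * _).
  rewrite -{1 3}(prednK K_gt0) factS prednK //.
  by rewrite -!mulnA; congr (_ * _); rewrite mulnC.
have [le_yn not_both] := gap_bounds x y gap_xy.
have [narrow|wide] := leqP y x.+1.
  rewrite gap_mult_empty ?mul0n; last by lia.
  by rewrite big_pred0 // => j; apply/andP => -[]; lia.
have lt_mid := mid_bnd x y gap_xy wide.
rewrite gap_mult_level ?level_le //.
have [levelE|level_neq] := eqVneq K (gap_level n x y); last first.
  rewrite big_pred0 // => j; apply/andP => -[lt_j /eqP prio_j].
  have := level_le x y gap_xy wide; have := gap_prio_le lt_j le_yn not_both.
  by rewrite -(prio_gap A0 gap_xy) // prio_j; move/eqP: level_neq; lia.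
rewrite mul1n; have [|a midE] := ord_of (mid x y); first by lia.
have predE j : (x < j.+1 < y) && (prio A j == K) =
    (j == a) || gap_tie n x y && (j.+1 == (x + y)./2.+1).
  apply/andP/idP => [[lt_j]|].
    rewrite (prio_gap A0 gap_xy) // levelE gap_prio_eq // -/(mid x y) midE.
    by rewrite eqSS.
  rewrite -[j == a]/(j == a :> nat) -eqSS -midE => j_eq.
  have lt_j : x < j.+1 < y.
    by case/orP: j_eq => [/eqP->//|/andP[]]; rewrite /gap_tie; lia.
  by rewrite (prio_gap A0 gap_xy) // levelE gap_prio_eq.
have V_pred j : (j == a) || gap_tie n x y && (j.+1 == (x + y)./2.+1) ->
    completion_count (j |: A) * 2 ^ gap_tie n x y = V.
  by rewrite -predE => /andP[lt_j /eqP prio_j]; apply: V_U1.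
rewrite (eq_bigl _ _ predE); case: (boolP (gap_tie n x y)) V_pred => /= [free|_] V_pred.
  (* In a tie, the two middles [a] and [b] contribute half of [V] each. *)
  have [|b bE] := ord_of (x + y)./2.+1; first by move: free; rewrite /gap_tie; lia.
  have nab : a != b.
    rewrite -[_ == _]/(a == b :> nat) -eqSS -midE -bE /mid.
    by move: free; rewrite /gap_tie negb_or => /andP[/andP[/negbTE-> /negbTE->]]; lia.
  rewrite (bigD1 a) ?eqxx //= (big_pred1 b) => [|j].
    have := V_pred a; rewrite eqxx => /(_ isT); have := V_pred b.
    by rewrite -bE eqxx orbT => /(_ isT); lia.
  rewrite bE eqSS val_eqE /=; case: (eqVneq j b) => [->|_].
    by rewrite orbT eq_sym nab.
  by rewrite orbF andbN.
rewrite (big_pred1 a) => [|j]; last by rewrite orbF.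
by have := V_pred a; rewrite eqxx muln1 => ->.
Qed.

(** The first person is recognized by the empty occupied set instead of by number, which makes the
    rule a function of [A] alone, as [runs] requires. *)
Definition obeys A : pred 'I_n := fun j => (A == set0) || rule_P5 A j.

(** Both sides satisfy the same recursion, and when the row is full all gaps are empty and both
    equal 1. *)
Lemma runs_completion_count m A : A != set0 -> m + #|A| = n ->
  runs obeys m A = completion_count A.
Proof.
elim: m A => [|m IHm] A A0 cardA /=.
  have AT : A = setT by apply/eqP; rewrite eqEcard subsetT cardsT card_ord -{1}cardA /=.
  have narrow x y : is_gap A x y -> y - x <= 1.
    move=> gap_xy; rewrite leqNgt; apply/negP => wide.
    have lt_xn : x < n by have := gap_ltn gap_xy; lia.
    by have := @gap_notin _ _ _ _ (Ordinal lt_xn) gap_xy; rewrite AT inE /=; lia.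
  have sum0 (F : nat -> nat -> nat) :
      (forall x y, y - x <= 1 -> F x y = 0) -> gap_sum F A = 0.
    move=> F0; rewrite (@eq_gap_sum _ _ (fun x y => 0 * 0)) ?gap_sumMr ?muln0 //.
    by move=> x y gap_xy; rewrite F0 // narrow.
  rewrite /completion_count sum0 ?muln1 => [|x y]; last exact: gap_even_empty.
  rewrite big1 // => k _; rewrite sum0 // => x y; exact: gap_mult_empty.
have AT : A != setT by apply: contra_eq_neq cardA => ->; rewrite cardsT card_ord; lia.
rewrite -sum_completion_count //; apply: eq_big => [j|j];
  rewrite /obeys (negbTE A0) //=.
rewrite rule_P5_prio // => /andP[jA _]; rewrite IHm //.
  by apply/set0Pn; exists j; rewrite setU11.
by rewrite cardsU1 jA; lia.
Qed.

Lemma P5_sum : 0 < n -> P5 n = \sum_(i < n) completion_count [set i].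
Proof.
move=> n_gt0.
have -> : P5 n = #|[set p : 'S_n | [forall j, obeys (occupied p (p j)) j]]|.
  apply: eq_card => p; rewrite !inE; apply: eq_forallb => j; congr (_ || _).
  apply/idP/idP => [/eqP->|/eqP occ0]; first by apply/eqP/setP => i; rewrite !inE.
  rewrite -leqn0 leqNgt; apply/negP => p_gt0; have := in_set0 (p^-1%g (Ordinal n_gt0)).
  by rewrite -occ0 inE permKV p_gt0.
rewrite card_perm_runs => [|A j]; last first.
  rewrite /obeys; have [->|A0] := eqVneq A set0; first by rewrite inE.
  by rewrite rule_P5_prio // => /andP[].
have runsE m : 0 < m ->
    runs obeys m set0 = \sum_(j | obeys set0 j) runs obeys m.-1 (j |: set0).
  by case: m.
rewrite runsE //; apply: eq_big => [j|j _]; first by rewrite /obeys eqxx.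
rewrite setU0 runs_completion_count ?cards1 ?addn1 ?prednK //.
by apply/set0Pn; exists j; rewrite inE.
Qed.

(** The value of [gap_mult] on an end gap of [l] payphones. *)
Definition end_mult (l k : nat) : nat :=
  if l == 0 then 0 else (k == l.+1) + level_mult (MS l.-1) k.

(** Here [l] and [r] are the numbers of payphones on the two sides of the first person. *)
Definition first_count (l r : nat) : nat :=
  (\prod_(k < n.+1) (end_mult l k + end_mult r k)`!)
  * 2 ^ (even_mult n (MS l.-1) + even_mult n (MS r.-1)).

Lemma first_countC l r : first_count l r = first_count r l.
Proof. by rewrite /first_count addnC; under eq_bigr do rewrite addnC. Qed.

Lemma completion_count1 i : completion_count [set i] = first_count i (n - i.+1).
Proof.
have sum1 F : gap_sum F [set i] = F 0 i.+1 + F i.+1 n.+1.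
  by rewrite /gap_sum /walls enum_set1 /= addn0.
have lt_in := ltn_ord i.
rewrite /completion_count sum1; congr (_ * 2 ^ (_ + _)).
- apply: eq_bigr => k _; rewrite sum1 /end_mult /gap_mult /= eqxx !subn0.
  have e : n.+1 - i.+1 = (n - i.+1).+1 by lia.
  rewrite e.
  by rewrite !ltnS !leqn0 !subSS !subn1.
- by rewrite /gap_even /= subSS subn1.
by rewrite /gap_even eqxx orbT subSS; congr (even_mult n (MS _)); lia.
Qed.
End Count.

(** * Translation into the function H and summation *)

(** For [l >= 2] the size 2l - 1 has level [l.+1], like the end gap. For [l = 1] it has level 1 but
    the end gap has level 2. *)
Lemma level_mult_MS' l k : l != 1 -> level_mult (MS' l) k = end_mult l k.
Proof.
case: l => [|[|l]] // _; first by rewrite /MS' level_mult0.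
rewrite /MS' level_multD addnC level_mult1; last by lia.
by rewrite /end_mult /=; congr (nat_of_bool (_ == _) + _);
  rewrite /level; case: ifP; lia.
Qed.

Lemma even_mult_MS' n l : even_mult n (MS' l) = even_mult n (MS l.-1).
Proof.
case: l => [|l]; first by [].
rewrite /MS' even_multD addnC {1}/even_mult big1 // => k _.
by rewrite msetnE; case: ifP; lia.
Qed.

Lemma MS_0 m : MS m 0 = 0.
Proof.
have [b le_mb] := ubnP m; elim: b m le_mb => // b IHb [|m] le_mb.
  by rewrite mset0E.
by rewrite MS_rec // !msetE2 msetnE !IHb //=; lia.
Qed.

Lemma MS'_0 l : MS' l 0 = 0.
Proof. by case: l => [|l]; rewrite ?mset0E // msetE2 msetnE MS_0; case: ifP; lia. Qed.

Lemma MS'_ge l k : 2 * l <= k -> MS' l k = 0.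
Proof.
by case: l => [|l] le_k; rewrite ?mset0E // msetE2 msetnE MS_gt; first case: ifP; lia.
Qed.

Lemma big_nat_trivial_tail R (idx : R) (op : Monoid.law idx) F m a b :
    a <= b -> (forall k, a <= k -> F k = idx) ->
  \big[op/idx]_(m <= k < a) F k = \big[op/idx]_(m <= k < b) F k.
Proof.
move=> le_ab F_tail; rewrite (big_nat_widen m a b) // big_mkcond.
by apply: eq_bigr => k _; case: ltnP => // /F_tail.
Qed.

(** The factor of index k in [H] belongs to level k + 1; levels 1 and 2 give the separate
    factorials, and level 0 gives 0! = 1. *)
Lemma H_level n (M : {mset nat}) : 1 < n -> M 0 = 0 ->
    (forall k, (2 * n).-1 <= k -> M k = 0) ->
  H M = \prod_(k < n.+1) (level_mult M k)`! * 2 ^ even_mult n M.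
Proof.
move=> n_gt1 M0 M_ge; rewrite /H; set D := (mset_max M).+1.
have M_D k : D <= k -> M k = 0 by exact: mset_gt_max.
have prod_cut : \prod_(2 <= k < D) (M (2 * k) + M (2 * k).-1)`! =
    \prod_(2 <= k < n) (M (2 * k) + M (2 * k).-1)`!.
  (* Both cuts, [D] and [n], are compared with [maxn D n]. *)
  rewrite (big_nat_trivial_tail _ _ (leq_maxl D n)) => [|k le_k]; last first.
    by case: k le_k => // k le_k; rewrite !M_D //; lia.
  rewrite -(big_nat_trivial_tail _ _ (leq_maxr D n)) // => k le_k.
  by rewrite !M_ge //; lia.
have sum_cut : \sum_(1 <= k < D) M (2 * k) = even_mult n M.
  rewrite (big_nat_trivial_tail _ _ (leq_maxl D n)) => [|k le_k]; last first.
    by rewrite M_D //; lia.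
  rewrite -(big_nat_trivial_tail _ _ (leq_maxr D n)) // => k le_k.
  by rewrite M_ge //; lia.
rewrite prod_cut sum_cut; congr (_ * _).
rewrite -(big_mkord xpredT (fun k => (level_mult M k)`!)).
have n1_gt2 : 2 < n.+1 by [].
have n1_gt1 : 1 < n.+1 by apply: ltnW.
rewrite [RHS]big_ltn // (big_ltn n1_gt1) (big_ltn n1_gt2).
rewrite {1 2 3}/level_mult M0 mul1n -mulnA mulnC [_`! * _`!]mulnC -mulnA.
congr (_ * (_ * _)); rewrite [RHS]big_add1; apply: eq_big_nat => k /andP[k_ge2 _].
rewrite /level_mult ifF; last by lia.
by congr (M _ + M _)`!; lia.
Qed.

Lemma P5_first n : 0 < n -> P5 n = \sum_(0 <= i < n) first_count n i (n - i.+1).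
Proof.
by move=> n_gt0; rewrite P5_sum // big_mkord; apply: eq_bigr => i _;
  rewrite completion_count1.
Qed.

Lemma first_countE n l r : 1 < n -> l != 1 -> r != 1 -> l + r < n ->
  first_count n l r = H (MS' l `+` MS' r).
Proof.
move=> n_gt1 l1 r1 lrn.
rewrite (@H_level n) // ?msetE2 ?MS'_0 // => [|k le_k]; last first.
  by rewrite msetE2 !MS'_ge //; lia.
rewrite even_multD !even_mult_MS'; congr (_ * _); apply: eq_bigr => k _.
by rewrite level_multD !level_mult_MS'.
Qed.

(** An end gap of one payphone has level 2, as does size 2, but has no tie; the factor 2 on the left
    makes up for it. *)
Lemma first_count1 n r : 1 < n -> r != 1 -> r.+1 < n ->
  2 * first_count n 1 r = H ([mset 2] `+` MS' r).
Proof.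
move=> n_gt1 r1 rn.
rewrite (@H_level n) // ?msetE2 ?MS'_0 ?msetnE // => [|k le_k]; last first.
  by rewrite msetE2 msetnE MS'_ge; first (case: ifP; lia); lia.
rewrite even_multD (@even_mult1 n 2) // even_mult_MS' /first_count /= even_mult0 add0n.
rewrite mulnCA -expnS; congr (_ * _); apply: eq_bigr => k _.
rewrite level_multD level_mult1 // level_mult_MS' //.
by rewrite {1}/end_mult /= level_mult0 addn0.
Qed.

Theorem theorem8 :
  [/\ P5 1 = 1, P5 2 = 2, P5 3 = 4 &
    forall n : nat, 4 <= n ->
      P5 n = 2 * H (MS' (n - 1)) + H ([mset 2] `+` MS' (n - 2))
             + \sum_(3 <= i < (n - 2).+1) H (MS' (i - 1) `+` MS' (n - i))].
Proof.
split.
- rewrite P5_first // big_nat1 /first_count /= !even_mult0.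
  by rewrite !big_ord_recl big_ord0.
- rewrite P5_first // /index_iota /= !big_cons big_nil /first_count /= !even_mult0.
  by rewrite !big_ord_recl !big_ord0 /end_mult /= !level_mult0.
(* End gaps have at most two payphones here, so only S(0) and S(1) occur. *)
- have MS1 k : level_mult (MS 1) k = (k == 1).
    by rewrite level_mult_MS // !level_mult0 !addn0.
  have even1 : even_mult 3 (MS 1) = 0.
    by rewrite even_mult_MS // !even_mult0.
  rewrite P5_first // /index_iota /= !big_cons big_nil /first_count /=.
  rewrite !even_mult0 even1.
  by rewrite !big_ord_recl !big_ord0 /end_mult /= !level_mult0 !MS1.
case=> [|[|[|[|n]]]] // _.
have -> : n.+4 - 1 = n.+3 by lia.
have -> : n.+4 - 2 = n.+2 by lia.
have -> : H (MS' n.+3) = first_count n.+4 0 n.+3 by rewrite first_countE // mset0D.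
(* The shift replaces the label of the first payphone by the number of payphones to its left. *)
rewrite -(@first_count1 n.+4) // big_add1 -pred_Sn.
have -> : \sum_(2 <= i < n.+2) H (MS' (i.+1 - 1) `+` MS' (n.+4 - i.+1)) =
    \sum_(2 <= i < n.+2) first_count n.+4 i (n.+4 - i.+1).
  by apply: eq_big_nat => i /andP[i_ge2 i_lt]; rewrite first_countE ?subn1 //; lia.
(* The two outermost positions at each end are split off; by symmetry they pair up into the first
   two terms of the formula. *)
rewrite P5_first // big_nat_recr // big_nat_recr // big_ltn // big_ltn //=.
rewrite subnn subSnn (first_countC _ n.+3 0) (first_countC _ n.+2 1).
have -> : n.+4 - 1 = n.+3 by lia.
have -> : n.+4 - 2 = n.+2 by lia.
by rewrite !mul2n -!addnn; lia.
Qed.
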